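(* Let $0\le\alpha<1$ and $1\le k\le n-2$. Let $\mathcal{D}_{n,k}$ be the set of strongly connected simple digraphs on $n$ vertices with vertex connectivity $k$, and $\mathcal{L}_{n,k}$ the set of strongly connected simple digraphs on $n$ vertices with arc connectivity $k$. Then a digraph with the minimum $A_\alpha$ spectral radius in $\mathcal{D}_{n,k}$ (respectively in $\mathcal{L}_{n,k}$) is $k$-regular, and $$\min\{\lambda_\alpha(G):G\in\mathcal{D}_{n,k}\}=\min\{\lambda_\alpha(G):G\in\mathcal{L}_{n,k}\}=k.$$
   Context: For a simple digraph $G$, $A(G)$ is the adjacency matrix, $D(G)$ the diagonal matrix of outdegrees, $A_\alpha(G)=\alpha D(G)+(1-\alpha)A(G)$, and the $A_\alpha$ spectral radius $\lambda_\alpha(G)$ is the largest modulus of the eigenvalues of $A_\alpha(G)$. Strongly connected: for every ordered pair of vertices there is a directed path from the first to the second. Vertex connectivity: minimum number of vertices whose deletion yields a non-strongly-connected digraph. Arc connectivity: minimum number of arcs whose deletion yields a non-strongly-connected digraph. A digraph is $k$-regular if every vertex has outdegree $k$ and indegree $k$. *)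

(* Defs.v *)
From mathcomp Require Import all_boot all_order all_algebra.
From mathcomp Require Import classical_sets cardinality reals complex.

Set Implicit Arguments.
Unset Strict Implicit.
Unset Printing Implicit Defensive.

Import Order.TTheory GRing.Theory Num.Theory.
Local Open Scope classical_set_scope.
Local Open Scope ring_scope.
Local Open Scope complex_scope.

Record digraph (n : nat) := Digraph {
  arc :> 'I_n -> 'I_n -> bool;
  arc_irr : irreflexive arc
}.

Definition outdeg (n : nat) (G : digraph n) (i : 'I_n) : nat :=
  #|[set j | G i j]%SET|.

Definition indeg (n : nat) (G : digraph n) (i : 'I_n) : nat :=
  #|[set j | G j i]%SET|.

Definition regular (n : nat) (k : nat) (G : digraph n) : Prop :=
  forall i : 'I_n, outdeg G i = k /\ indeg G i = k.

Definition strongly_connected (T : finType) (e : rel T) : bool :=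
  [forall x, forall y, connect e x y].

Definition delete_vertices (n : nat) (G : digraph n) (S : {set 'I_n}) :
    rel {x : 'I_n | x \notin S} :=
  fun x y => G (val x) (val y).

Definition arcs (n : nat) (G : digraph n) : {set 'I_n * 'I_n} :=
  [set p | G p.1 p.2]%SET.

Definition delete_arcs (n : nat) (G : digraph n) (F : {set 'I_n * 'I_n}) :
    rel 'I_n :=
  fun x y => G x y && ((x, y) \notin F).

Definition is_min (d : Order.disp_t) (T : porderType d) (A : set T) (m : T) :
    Prop :=
  A m /\ lbound A m.

(* [strongly_connected] holds vacuously of the digraph with no vertex, so a
   complete digraph has no vertex cut and no [k] is its vertex connectivity.
   The usual conventions (n - 1) differ only at values k > n - 2. *)
Definition vertex_connectivity (n : nat) (G : digraph n) (k : nat) : Prop :=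
  is_min [set #|S| | S in [set S : {set 'I_n} |
            ~~ strongly_connected (@delete_vertices n G S)]] k.

Definition arc_connectivity (n : nat) (G : digraph n) (k : nat) : Prop :=
  is_min [set #|F| | F in [set F : {set 'I_n * 'I_n} |
            (F \subset arcs G) && ~~ strongly_connected (delete_arcs G F)]] k.

Definition adjacency_mx (R : realType) (n : nat) (G : digraph n) : 'M[R]_n :=
  \matrix_(i, j) (G i j)%:R.

Definition outdegree_mx (R : realType) (n : nat) (G : digraph n) : 'M[R]_n :=
  diag_mx (\row_i (outdeg G i)%:R).

Definition A_alpha (R : realType) (alpha : R) (n : nat) (G : digraph n) :
    'M[R]_n :=
  alpha *: outdegree_mx R G + (1 - alpha) *: adjacency_mx R G.

Definition eigenvalue_moduli (R : realType) (n : nat) (A : 'M[R]_n) : set R :=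
  [set Normc.normc z | z in
     [set z : R[i] | eigenvalue (map_mx (real_complex R) A) z]].

(* The supremum is a maximum for n > 0, see [spectral_radius_max]; the
   eigenvalues are the complex ones. *)
Definition spectral_radius (R : realType) (n : nat) (A : 'M[R]_n) : R :=
  sup (eigenvalue_moduli A).

Definition lambda_alpha (R : realType) (alpha : R) (n : nat) (G : digraph n) :
    R :=
  spectral_radius (A_alpha alpha G).

Definition D_nk (n k : nat) : set (digraph n) :=
  [set G : digraph n | strongly_connected G /\ vertex_connectivity G k].
Arguments D_nk : clear implicits.

Definition L_nk (n k : nat) : set (digraph n) :=
  [set G : digraph n | strongly_connected G /\ arc_connectivity G k].
Arguments L_nk : clear implicits.

Lemma seq_max (R : realType) (s : seq R) (x : R) : x \in s ->
  exists2 m, m \in s & forall y, y \in s -> y <= m.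
Proof.
elim: s x => [//|a s IHs] x _; case: s IHs => [_|b s /(_ b)].
  by exists a; rewrite ?mem_head // => y; rewrite inE => /eqP ->.
case; first exact: mem_head.
move=> m ms mmax; have [am|ma] := leP a m.
  exists m; first by rewrite in_cons ms orbT.
  by move=> y; rewrite in_cons => /orP[/eqP -> //|/mmax].
exists a; first exact: mem_head.
move=> y; rewrite in_cons => /orP[/eqP -> //|/mmax ym].
exact: le_trans ym (ltW ma).
Qed.

Lemma spectral_radius_max (R : realType) (n : nat) (A : 'M[R]_n) : (0 < n)%N ->
  eigenvalue_moduli A (spectral_radius A) /\
  ubound (eigenvalue_moduli A) (spectral_radius A).
Proof.
move=> n_gt0; set B := map_mx (real_complex R) A.
have [s Bs] := closed_field_poly_normal (char_poly B).
have sE z : eigenvalue B z = (z \in s).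
  rewrite eigenvalue_root_char Bs (monicP (char_poly_monic B)) scale1r.
  by rewrite root_prod_XsubC.
have [z zs] : exists z, z \in s.
  case: s Bs {sE} => [Bs|z s _]; last by exists z; rewrite mem_head.
  have := size_char_poly B; rewrite Bs big_nil alg_polyC size_polyC.
  by case: (_ != 0) => //= -[n0]; rewrite -n0 in n_gt0.
have /seq_max[m ms mmax] : Normc.normc z \in map (@Normc.normc R) s.
  exact: map_f.
have Am : eigenvalue_moduli A m.
  by case/mapP: ms => w ws ->; exists w => //=; rewrite sE.
have ubm : ubound (eigenvalue_moduli A) m.
  by move=> _ [w /= + <-]; rewrite sE => ws; apply: mmax; apply: map_f.
suff -> : spectral_radius A = m by [].
apply/eqP; rewrite eq_le; apply/andP; split.
  by apply: ge_sup => //; exists m.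
by apply: ub_le_sup => //; exists m.
Qed.

(* Main.v *)
(* The row sums of [A_alpha G] are the outdegrees of [G]. Deleting all
   out-neighbours (or all arcs leaving) a vertex destroys strong connectivity, so
   connectivity [k] forces every outdegree, and likewise every indegree, to be at
   least [k]. If [y] is a positive left Perron vector of eigenvalue [t], summing
   the entries of [y A = t y] gives [\sum_i y_i (outdeg i - t) = 0]; hence
   [t >= k], with equality only if all outdegrees are [k], and then double
   counting of the arcs makes all indegrees [k] too. The bound is attained by the
   circulant digraph with arcs from [i] to [i + 1], ..., [i + k]. *)
Require Import Defs.
From mathcomp Require Import all_boot all_order all_algebra.
From mathcomp Require Import classical_sets cardinality reals complex.
From mathcomp Require Import boolp topology normedtype derive.
From mathcomp Require Import zify.

Set Implicit Arguments.
Unset Strict Implicit.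
Unset Printing Implicit Defensive.

Import Order.TTheory GRing.Theory Num.Theory.
Import numFieldNormedType.Exports.
Local Open Scope classical_set_scope.
Local Open Scope ring_scope.

(** * Perron vectors *)

Lemma expmx_ge0 (R : realDomainType) (n : nat) (A : 'M[R]_n) (m : nat) :
  (forall i j, 0 <= A i j) -> forall i j, 0 <= (A ^+ m) i j.
Proof.
move=> A0; elim: m => [|m IHm] i j; first by rewrite expr0 mxE ler0n.
by rewrite exprS mxE; apply: sumr_ge0 => l _; rewrite mulr_ge0.
Qed.

Lemma expmx_connect_gt0 (R : realDomainType) (n : nat) (A : 'M[R]_n)
    (i j : 'I_n) :
  (forall i j, 0 <= A i j) -> connect (fun x y => 0 < A x y) i j ->
  exists m, 0 < (A ^+ m) i j.
Proof.
move=> A0 /connectP[p]; elim: p i => [|l p IHp] i /=.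
  by move=> _ ->; exists 0; rewrite expr0 mxE eqxx ltr01.
case/andP=> Ail /IHp{}IHp /IHp[m Am]; exists m.+1.
rewrite exprS mxE (bigD1 l)//= ltr_pwDl ?mulr_gt0//.
by apply: sumr_ge0 => h _; rewrite mulr_ge0 ?expmx_ge0.
Qed.

(** For each pair of indices some power of [A] is positive at that entry. The sum of these powers is
    positive everywhere and commutes with [A]. *)
Lemma irreducible_commuting_gt0 (R : realDomainType) (n : nat) (A : 'M[R]_n) :
  (forall i j, 0 <= A i j) ->
  (forall i j, connect (fun x y => 0 < A x y) i j) ->
  exists2 P : 'M[R]_n, P *m A = A *m P & forall i j, 0 < P i j.
Proof.
move=> A0 Ac.
have [f fP] := fin_all_exists (fun ij : 'I_n * 'I_n =>
  expmx_connect_gt0 A0 (Ac ij.1 ij.2)).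
exists (\sum_ij A ^+ f ij).
  rewrite mulmx_suml mulmx_sumr; apply: eq_bigr => ij _.
  exact: etrans (esym (exprSr A _)) (exprS A _).
move=> i j; rewrite summxE (bigD1 (i, j))//= ltr_pwDl ?fP//.
by apply: sumr_ge0 => h _; rewrite expmx_ge0.
Qed.

Lemma pos_lower_bound (R : realFieldType) (I : finType) (F : I -> R) :
  (forall i, 0 < F i) -> exists2 e, 0 < e & forall i, e <= F i.
Proof.
move=> F0; pose S := 1 + \sum_i (F i)^-1.
have Fi0 i : 0 <= (F i)^-1 by rewrite invr_ge0 ltW.
have S0 : 0 < S by rewrite ltr_pwDl ?ltr01 ?sumr_ge0.
exists S^-1; first by rewrite invr_gt0.
move=> i; rewrite -[leRHS]invrK lef_pV2 ?posrE ?invr_gt0//.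
rewrite /S (bigD1 i)//= addrCA lerDl addr_ge0 ?ler01//.
by apply: sumr_ge0.
Qed.

Lemma mulmx_row_ge0 (R : realDomainType) (n : nat) (v : 'rV[R]_n) (A : 'M[R]_n) :
  (forall i, 0 <= v 0 i) -> (forall i j, 0 <= A i j) ->
  forall j, 0 <= (v *m A) 0 j.
Proof. by move=> v0 A0 j; rewrite mxE; apply: sumr_ge0 => i _; rewrite mulr_ge0. Qed.

Lemma mulmx_row_gt0 (R : realDomainType) (n : nat) (v : 'rV[R]_n) (A : 'M[R]_n) :
  (forall i, 0 <= v 0 i) -> v != 0 -> (forall i j, 0 < A i j) ->
  forall j, 0 < (v *m A) 0 j.
Proof.
move=> v0 /rV0Pn[i vi] A0 j; rewrite mxE (bigD1 i)//= ltr_pwDl//.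
  by rewrite mulr_gt0// lt_def vi v0.
by apply: sumr_ge0 => l _; rewrite mulr_ge0// ltW.
Qed.

Lemma sum_mulmx_row (R : pzRingType) (n : nat) (v : 'rV[R]_n) (A : 'M[R]_n) :
  \sum_j (v *m A) 0 j = \sum_i v 0 i * \sum_j A i j.
Proof.
under eq_bigr do rewrite mxE; rewrite exchange_big /=.
by under eq_bigr do rewrite -mulr_sumr.
Qed.

(** The number is carried along with the vector, so that the Collatz-Wielandt maximum is that of a
    projection. Signs are imposed separately, by a compact box. *)
Definition subeigen (R : realType) (n : nat) (A : 'M[R]_n) :=
  [set p : 'rV[R]_n * R | (forall j, p.2 * p.1 0 j <= (p.1 *m A) 0 j) /\ \sum_j p.1 0 j = 1].

Lemma closed_subeigen (R : realType) (n : nat) (A : 'M[R]_n) :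
  closed (subeigen A).
Proof.
have cc j : continuous (fun p : 'rV[R]_n * R => p.1 0 j).
  move=> p; apply: (@continuous_comp _ _ _ fst (fun v : 'rV[R]_n => v 0 j)).
    exact: cvg_fst.
  exact: coord_continuous.
pose f j (p : 'rV[R]_n * R) : R := (p.1 *m A) 0 j - p.2 * p.1 0 j.
pose g (p : 'rV[R]_n * R) : R := \sum_j p.1 0 j.
have cf j : continuous (f j).
  rewrite (_ : f j = fun p => \sum_i p.1 0 i * A i j - p.2 * p.1 0 j).
    move=> p; apply: cvgB; last by apply: cvgM; [exact: cvg_snd|exact: cc].
    apply: continuous_big => [|i _]; first exact: add_continuous.
    by move=> q; apply: cvgM; [exact: cc|exact: cvg_cst].
  by apply/funext => p; rewrite /f mxE.
have cg : continuous g.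
  by apply: continuous_big => [|i _]; [exact: add_continuous|exact: cc].
have -> : subeigen A =
    (\bigcap_j (f j @^-1` [set x | 0 <= x])) `&` (g @^-1` [set x | x = 1]).
  apply/seteqP; split=> p /= [h1 h2]; split=> // j.
    by move=> _; rewrite /f /= subr_ge0.
  by have := h1 j I; rewrite /f /= subr_ge0.
apply: closedI.
  apply: closed_bigI => j _; apply: preimage_closed; last exact: closed_ge.
  by move=> p _; exact: cf.
apply: preimage_closed; last exact: closed_eq.
by move=> p _; exact: cg.
Qed.

(* The Collatz-Wielandt argument: the largest [t] with [t y <= y A] for a
   probability vector [y] is an eigenvalue, for otherwise a positive matrix
   commuting with [A] would make the inequality strict everywhere. *)
Lemma perron_left (R : realType) (n : nat) (A : 'M[R]_n) :
  (0 < n)%N -> (forall i j, 0 <= A i j) ->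
  (forall i j, connect (fun x y => 0 < A x y) i j) ->
  exists t, exists2 y : 'rV[R]_n, forall i, 0 < y 0 i & y *m A = t *: y.
Proof.
move=> n0 A0 Ac; pose i0 := Ordinal n0.
pose M := \sum_i \sum_j A i j.
(* The sum [M] of all entries bounds every row sum. Adding up the coordinates of [s x <= x A] for a
   probability vector [x] gives [s <= M], so the box below misses no candidate. *)
have r0 i : 0 <= \sum_j A i j by apply: sumr_ge0.
have rM i : \sum_j A i j <= M.
  by rewrite /M [leRHS](bigD1 i)//= lerDl sumr_ge0.
pose B := [set v : 'rV[R]_n | forall i, `[0, 1]%classic (v ord0 i)] `*` `[0, M]%classic.
have [|||[y t]] := @compact_EVT_max _ R snd (B `&` subeigen A).
- exists (delta_mx 0 i0, 0); split; [split=> /= [i|]|split=> /= [j|]].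
  + by rewrite in_itv /= mxE ler0n lern1 leq_b1.
  + by rewrite in_itv /= lexx sumr_ge0.
  + by rewrite mul0r mulmx_row_ge0// => i; rewrite mxE ler0n.
  + rewrite (bigD1 i0)//= big1 ?mxE ?eqxx ?addr0// => j /negPf ji.
    by rewrite mxE ji andbF.
- apply: compact_closedI; last exact: closed_subeigen.
  apply: compact_setX; last exact: segment_compact.
  apply: (@rV_compact R n (fun=> `[0, 1]%classic)) => i; exact: segment_compact.
- by apply: continuous_subspaceT => p; exact: cvg_snd.
rewrite inE => -[[/= yI tI]] [/= yA y1] tmax.
have y0 i : 0 <= y 0 i by have /andP[] := yI i.
have t0 : 0 <= t by have /andP[] := tI.
have ynz : y != 0.
  apply/eqP => yE; move: y1; rewrite yE big1 => [/eqP|i _]; last by rewrite mxE.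
  by rewrite eq_sym oner_eq0.
(* Maximality of [t] extends to positive vectors of any total mass, by normalization. *)
have sub_le (s : R) (x : 'rV[R]_n) : 0 <= s -> (forall i, 0 < x 0 i) ->
    (forall j, s * x 0 j <= (x *m A) 0 j) -> s <= t.
  move=> s0 x0 sx; pose S := \sum_i x 0 i.
  have S0 : 0 < S.
    by rewrite /S (bigD1 i0)//= ltr_pwDl// sumr_ge0// => i _; rewrite ltW.
  apply: (tmax (S^-1 *: x, s)); rewrite inE; split; [split=> /= [i|]|split=> /= [j|]].
  - rewrite in_itv /= mxE mulrC ler_pdivrMr// mul1r.
    rewrite divr_ge0 ?(ltW (x0 _)) ?(ltW S0)//=.
    by rewrite /S (bigD1 i)//= lerDl sumr_ge0// => j _; rewrite ltW.
  - rewrite in_itv /= s0 -(ler_pM2r S0) mulr_sumr.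
    apply: le_trans (ler_sum _ (fun j _ => sx j)) _.
    rewrite sum_mulmx_row mulr_sumr; apply: ler_sum => i _.
    by rewrite mulrC ler_wpM2r// ltW.
  - rewrite -scalemxAl [leRHS]mxE [X in _ * X <= _]mxE mulrCA.
    by rewrite ler_wpM2l ?sx// invr_ge0 ltW.
  - under eq_bigr do rewrite mxE.
    by rewrite -mulr_sumr mulVf// gt_eqF.
have yAE : y *m A = t *: y.
  have [//|yAn] := eqVneq (y *m A) (t *: y).
  have [P PA P0] := irreducible_commuting_gt0 A0 Ac.
  (* The defect [z] is nonnegative and nonzero, so [z P = x A - t x] is positive. Hence it dominates
     [e x] for some [e > 0], and [t + e] contradicts maximality. *)
  pose z := y *m A - t *: y; pose x := y *m P.
  have x0 : forall i, 0 < x 0 i by exact: mulmx_row_gt0.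
  have zP0 : forall i, 0 < (z *m P) 0 i.
    apply: mulmx_row_gt0 => //; last by rewrite subr_eq0.
    by move=> i; rewrite /z [leRHS]mxE [X in _ + X]mxE [X in _ - X]mxE subr_ge0.
  have [e e0 ez] := pos_lower_bound (fun i => divr_gt0 (zP0 i) (x0 i)).
  suff : t + e <= t by rewrite gerDl leNgt e0.
  apply: (sub_le _ x) => //; first by rewrite addr_ge0// ltW.
  move=> j; rewrite mulrDl -lerBrDl.
  have -> : (x *m A) 0 j - t * x 0 j = (z *m P) 0 j.
    rewrite /z mulmxBl -scalemxAl -(mulmxA y A P) -PA mulmxA -/x.
    by rewrite [RHS]mxE; congr (_ + _); rewrite !mxE.
  by rewrite -ler_pdivlMr.
exists t, y => // j.
(* Positivity of [y]: if [y_j = 0], then coordinate [j] of [y A^m] vanishes for all [m], yet a path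
   from the support of [y] to [j] makes it positive for some [m]. *)
have yAm m : y *m A ^+ m = t ^+ m *: y.
  elim: m => [|m IHm]; first by rewrite !expr0 scale1r; exact: mulmx1.
  rewrite exprSr [_ * _]/(_ *m _) mulmxA IHm -scalemxAl yAE scalerA.
  by rewrite -exprSr.
have /rV0Pn[i yi] := ynz.
have [m Am] := expmx_connect_gt0 A0 (Ac i j).
rewrite lt_def y0 andbT; apply/eqP => yj0.
have := congr1 (fun v : 'rV[R]_n => v 0 j) (yAm m).
rewrite !mxE yj0 mulr0 (bigD1 i)//= => /eqP; rewrite gt_eqF//.
rewrite ltr_pwDl//; first by rewrite mulr_gt0// lt_def yi y0.
by apply: sumr_ge0 => l _; rewrite mulr_ge0// expmx_ge0.
Qed.

(** * The spectral radius of A_alpha *)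

Lemma spectral_radius_ge_eigen (R : realType) (n : nat) (A : 'M[R]_n) (t : R)
    (y : 'rV[R]_n) :
  (0 < n)%N -> y != 0 -> y *m A = t *: y -> t <= spectral_radius A.
Proof.
move=> n0 y0 yA; apply: le_trans (ler_norm t) _.
apply: (spectral_radius_max A n0).2.
exists (real_complex R t); last by rewrite /= expr0n addr0 sqrtr_sqr.
apply/eigenvalueP; exists (map_mx (real_complex R) y).
  by rewrite -map_mxM yA map_mxZ.
by rewrite map_mx_eq0.
Qed.

(** Eigenvectors are row vectors here. Taking the l1 norm of [v A = z v] bounds [|z|] by a weighted
    mean of row sums, with weights [|v_i|]. *)
Lemma spectral_radius_le_row_sum (R : realType) (n : nat) (A : 'M[R]_n) (s : R) :
  (0 < n)%N -> (forall i j, 0 <= A i j) -> (forall i, \sum_j A i j <= s) ->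
  spectral_radius A <= s.
Proof.
move=> n0 A0 As; have [[z /= /eigenvalueP[v vA vn0] <-] _] := spectral_radius_max A n0.
rewrite -lecR -[leLHS]/(`|z|).
have /rV0Pn[i vi] := vn0.
have S0 : 0 < \sum_j `|v 0 j|.
  rewrite (bigD1 i)//= ltr_pwDl ?normr_gt0// sumr_ge0//.
rewrite -(ler_pM2r S0) mulr_sumr.
have -> : \sum_j `|z| * `|v 0 j| =
    \sum_j `|(v *m map_mx (real_complex R) A) 0 j|.
  by apply: eq_bigr => j _; rewrite vA mxE normrM.
apply: (@le_trans _ _ (\sum_j \sum_i `|v 0 i| * real_complex R (A i j))).
  apply: ler_sum => j _; rewrite mxE; apply: le_trans (ler_norm_sum _ _ _) _.
  apply: ler_sum => l _; rewrite normrM mxE [X in _ * X]ger0_norm//.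
  by rewrite lecR.
rewrite exchange_big mulr_sumr; apply: ler_sum => l _ /=.
by rewrite -mulr_sumr -rmorph_sum /= mulrC ler_wpM2r// lecR.
Qed.

Lemma A_alphaE (R : realType) (alpha : R) (n : nat) (G : digraph n) i j :
  A_alpha alpha G i j =
    alpha * ((outdeg G i)%:R *+ (i == j)) + (1 - alpha) * (G i j)%:R.
Proof. by rewrite !mxE. Qed.

Lemma A_alpha_ge0 (R : realType) (alpha : R) (n : nat) (G : digraph n) i j :
  0 <= alpha < 1 -> 0 <= A_alpha alpha G i j.
Proof.
move=> /andP[a0 a1]; rewrite A_alphaE addr_ge0 ?mulr_ge0 ?ler0n//.
  by rewrite mulrn_wge0.
by rewrite subr_ge0 ltW.
Qed.

Lemma A_alpha_row_sum (R : realType) (alpha : R) (n : nat) (G : digraph n) i :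
  \sum_j A_alpha alpha G i j = (outdeg G i)%:R.
Proof.
under eq_bigr do rewrite A_alphaE.
rewrite big_split /= -!mulr_sumr.
have -> : \sum_j ((outdeg G i)%:R *+ (i == j)) = (outdeg G i)%:R :> R.
  rewrite (bigD1 i)//= eqxx big1 ?addr0// => j /negPf.
  by rewrite eq_sym => ->.
rewrite -natr_sum /outdeg -sum1dep_card big_mkcond /=.
rewrite -mulrDl addrC subrK mul1r.
by congr (_%:R).
Qed.

Lemma strongly_connected_A_alpha (R : realType) (alpha : R) (n : nat)
    (G : digraph n) :
  0 <= alpha < 1 -> strongly_connected G ->
  forall i j, connect (fun x y => 0 < A_alpha alpha G x y) i j.
Proof.
move=> alphaP /forallP Gc i j; have /forallP/(_ j) := Gc i.
apply: connect_sub => {j}x y Gxy; apply: connect1.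
have /andP[a0 a1] := alphaP.
rewrite A_alphaE Gxy ltr_pwDr ?mulr1 ?subr_gt0//.
by rewrite mulr_ge0// mulrn_wge0.
Qed.

Lemma outdeg_lambda_alpha (R : realType) (alpha : R) (n d : nat)
    (G : digraph n) :
  0 <= alpha < 1 -> (0 < n)%N -> strongly_connected G ->
  (forall i, (d <= outdeg G i)%N) ->
  d%:R <= lambda_alpha alpha G /\
  (lambda_alpha alpha G = d%:R -> forall i, outdeg G i = d).
Proof.
move=> alphaP n0 Gc dG.
have [t [y y0 yA]] := perron_left n0 (fun i j => A_alpha_ge0 G i j alphaP)
  (strongly_connected_A_alpha alphaP Gc).
have tl : t <= lambda_alpha alpha G.
  apply: spectral_radius_ge_eigen yA => //.
  by apply/rV0Pn; exists (Ordinal n0); rewrite gt_eqF.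
have sumE : \sum_i y 0 i * ((outdeg G i)%:R - t) = 0.
  under eq_bigr do rewrite mulrBr.
  rewrite sumrB -mulr_suml; under eq_bigr do rewrite -(A_alpha_row_sum alpha).
  rewrite -sum_mulmx_row yA mulr_suml; apply/eqP; rewrite subr_eq0; apply/eqP.
  by apply: eq_bigr => i _; rewrite mxE mulrC.
(* When [t <= d], all terms of the vanishing sum are nonnegative, hence zero. This excludes [t < d]
   and also settles the equality case, where [t <= lambda_alpha alpha G = d]. *)
have td : t <= d%:R -> forall i, (outdeg G i)%:R = t.
  move=> td i; apply/eqP; rewrite -subr_eq0.
  have F0 l : true -> 0 <= y 0 l * ((outdeg G l)%:R - t).
    by rewrite mulr_ge0 ?(ltW (y0 _))// subr_ge0 (le_trans td)// ler_nat.
  have /eqP := psumr_eq0P F0 sumE (i := i) isT.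
  by rewrite mulf_eq0 gt_eqF.
split.
  apply: le_trans tl; rewrite leNgt; apply/negP => tlt.
  have := td (ltW tlt) (Ordinal n0) => dE.
  by move: tlt; rewrite -dE ltr_nat ltnNge dG.
move=> lE i; apply/eqP; rewrite eqn_leq dG andbT -(@ler_nat R) td -lE//.
Qed.

Lemma lambda_alpha_outregular (R : realType) (alpha : R) (n d : nat)
    (G : digraph n) :
  0 <= alpha < 1 -> (0 < n)%N -> strongly_connected G ->
  (forall i, outdeg G i = d) -> lambda_alpha alpha G = d%:R.
Proof.
move=> alphaP n0 Gc dG; apply/eqP; rewrite eq_le.
rewrite (outdeg_lambda_alpha alphaP n0 Gc (d := d) _).1 ?andbT; last first.
  by move=> i; rewrite dG.
apply: spectral_radius_le_row_sum => // [i j|i]; first exact: A_alpha_ge0.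
by rewrite A_alpha_row_sum dG.
Qed.

Lemma outregular_regular (n d : nat) (G : digraph n) :
  (forall i, outdeg G i = d) -> (forall i, (d <= indeg G i)%N) -> regular d G.
Proof.
move=> dG dI.
have sumE : (\sum_i indeg G i = \sum_(i < n) d)%N.
  transitivity (\sum_i outdeg G i)%N; last by apply: eq_bigr.
  rewrite /indeg /outdeg.
  under eq_bigr do rewrite -sum1dep_card big_mkcond.
  rewrite exchange_big; apply: eq_bigr => i _.
  by rewrite -sum1dep_card [RHS]big_mkcond.
move=> i; split=> //; apply/esym/eqP.
have [_] := leqif_sum (fun j (_ : true) => leqif_eq (dI j)).
by rewrite sumE eqxx => /esym/forallP/(_ i).
Qed.

(** * Vertex and arc cuts *)

Lemma strongly_connected_out (T : finType) (e : rel T) (x y : T) :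
  strongly_connected e -> x != y -> exists z, e x z.
Proof.
move=> /forallP/(_ x)/forallP/(_ y)/connectP[[|z p] /= ep yE xy].
  by rewrite yE eqxx in xy.
by exists z; case/andP: ep.
Qed.

Lemma strongly_connected_in (T : finType) (e : rel T) (x y : T) :
  strongly_connected e -> x != y -> exists z, e z y.
Proof.
move=> /forallP/(_ x)/forallP/(_ y)/connectP[p]; case/lastP: p => [|p z] ep yE xy.
  by rewrite yE eqxx in xy.
rewrite last_rcons in yE; rewrite rcons_path -yE in ep.
by exists (last x p); case/andP: ep.
Qed.

Lemma connect_invariant (T : finType) (e : rel T) (P : pred T) (x y : T) :
  (forall a b, e a b -> P a -> P b) -> connect e x y -> P x -> P y.
Proof.
move=> eP /connectP[p]; elim: p x => [|z p IHp] x /= => [_ -> //|].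
by case/andP=> /eP xz /IHp{}IHp /IHp{}IHp /xz.
Qed.

Lemma exists_notin_neq (T : finType) (S : {set T}) (i : T) :
  (#|S|.+1 < #|T|)%N -> exists2 y, y \notin S & y != i.
Proof.
move=> ST; have : ~~ ([set: T]%SET \subset i |: S).
  apply: contraL ST => /subset_leq_card; rewrite cardsT -leqNgt => /leq_trans.
  by apply; rewrite cardsU1 -add1n leq_add2r leq_b1.
by move=> /subsetPn[y _]; rewrite !inE negb_or => /andP[yi yS]; exists y.
Qed.

(** The degree bound leaves a vertex besides [i], which [i] can no longer reach. A lone remaining
    vertex would still be strongly connected. *)
Lemma delete_outneighbours (n : nat) (G : digraph n) (i : 'I_n) :
  ((outdeg G i).+1 < n)%N ->
  ~~ strongly_connected (@delete_vertices n G [set j | G i j]%SET).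
Proof.
set S := [set j | G i j]%SET => lt_n; apply/negP => Gc.
have iS : i \notin S by rewrite inE arc_irr.
have [|y yS yi] := @exists_notin_neq _ S i; first by rewrite card_ord.
have [|z] := @strongly_connected_out _ _ (Sub i iS) (Sub y yS) Gc.
  by rewrite -val_eqE /= eq_sym.
by rewrite /delete_vertices /= => Giz; have := valP z; rewrite /= inE Giz.
Qed.

Lemma delete_inneighbours (n : nat) (G : digraph n) (i : 'I_n) :
  ((indeg G i).+1 < n)%N ->
  ~~ strongly_connected (@delete_vertices n G [set j | G j i]%SET).
Proof.
set S := [set j | G j i]%SET => lt_n; apply/negP => Gc.
have iS : i \notin S by rewrite inE arc_irr.
have [|y yS yi] := @exists_notin_neq _ S i; first by rewrite card_ord.
have [|z] := @strongly_connected_in _ _ (Sub y yS) (Sub i iS) Gc.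
  by rewrite -val_eqE.
by rewrite /delete_vertices /= => Giz; have := valP z; rewrite /= inE Giz.
Qed.

Definition out_arcs (n : nat) (G : digraph n) (i : 'I_n) : {set 'I_n * 'I_n} :=
  [set (i, j) | j in [set j | G i j]]%SET.

Definition in_arcs (n : nat) (G : digraph n) (i : 'I_n) : {set 'I_n * 'I_n} :=
  [set (j, i) | j in [set j | G j i]]%SET.

Lemma card_out_arcs (n : nat) (G : digraph n) (i : 'I_n) :
  #|out_arcs G i| = outdeg G i.
Proof. by rewrite card_imset// => x y []. Qed.

Lemma card_in_arcs (n : nat) (G : digraph n) (i : 'I_n) :
  #|in_arcs G i| = indeg G i.
Proof. by rewrite card_imset// => x y []. Qed.

Lemma delete_out_arcs (n : nat) (G : digraph n) (i : 'I_n) : (1 < n)%N ->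
  (out_arcs G i \subset arcs G) &&
  ~~ strongly_connected (delete_arcs G (out_arcs G i)).
Proof.
move=> n1; apply/andP; split.
  by apply/fintype.subsetP => _ /imsetP[j + ->]; rewrite !inE.
apply/negP => Gc.
have [|y _ yi] := @exists_notin_neq _ finset.set0 i; first by rewrite card_ord cards0.
rewrite eq_sym in yi; have [z /andP[Giz]] := strongly_connected_out Gc yi.
by rewrite imset_f ?inE.
Qed.

Lemma delete_in_arcs (n : nat) (G : digraph n) (i : 'I_n) : (1 < n)%N ->
  (in_arcs G i \subset arcs G) &&
  ~~ strongly_connected (delete_arcs G (in_arcs G i)).
Proof.
move=> n1; apply/andP; split.
  by apply/fintype.subsetP => _ /imsetP[j + ->]; rewrite !inE.
apply/negP => Gc.
have [|y _ yi] := @exists_notin_neq _ finset.set0 i; first by rewrite card_ord cards0.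
have [z /andP[Gzi]] := strongly_connected_in Gc yi.
by rewrite (imset_f (fun j => (j, i))) ?inE.
Qed.

Lemma vertex_connectivity_degree (n k : nat) (G : digraph n) :
  (k.+1 < n)%N -> vertex_connectivity G k ->
  forall i, (k <= outdeg G i)%N /\ (k <= indeg G i)%N.
Proof.
move=> kn [_ lbk] i; split.
  (* An outdegree of at least [n - 1] already exceeds [k]; otherwise the out-neighbours form a
     cut. *)
  case: (ltnP (outdeg G i).+1 n) => [Gn|]; last lia.
  by apply: lbk; exists [set j | G i j]%SET => //=; exact: delete_outneighbours.
case: (ltnP (indeg G i).+1 n) => [Gn|]; last lia.
by apply: lbk; exists [set j | G j i]%SET => //=; exact: delete_inneighbours.
Qed.

Lemma arc_connectivity_degree (n k : nat) (G : digraph n) :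
  (1 < n)%N -> arc_connectivity G k ->
  forall i, (k <= outdeg G i)%N /\ (k <= indeg G i)%N.
Proof.
move=> n1 [_ lbk] i; split.
  rewrite -card_out_arcs; apply: lbk.
  by exists (out_arcs G i) => //=; exact: delete_out_arcs.
rewrite -card_in_arcs; apply: lbk.
by exists (in_arcs G i) => //=; exact: delete_in_arcs.
Qed.

(* Whitney: [F] contains all arcs from the set [X] of vertices still reachable
   from some [x] to its complement. Since [F] is small, some [u] in [X] and [v]
   outside [X] are not joined by an arc, and every arc of the cut has an end
   different from [u] and [v]. *)
Lemma arc_cut_vertex_cut (n : nat) (G : digraph n) (F : {set 'I_n * 'I_n}) :
  (#|F|.+1 < n)%N -> F \subset arcs G ->
  ~~ strongly_connected (delete_arcs G F) ->
  exists2 S : {set 'I_n}, (#|S| <= #|F|)%N &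
    ~~ strongly_connected (@delete_vertices n G S).
Proof.
move=> Fn /fintype.subsetP FG /forallPn[x /forallPn[y xy]].
pose X := [set z | connect (delete_arcs G F) x z]%SET.
have xX : x \in X by rewrite inE connect0.
have yX : y \notin X by rewrite inE.
have XF a b : a \in X -> b \notin X -> G a b -> (a, b) \in F.
  rewrite !inE => xa /negP xb Gab; apply/negPn/negP => abF; apply: xb.
  by apply: connect_trans xa (connect1 _); rewrite /delete_arcs Gab.
have [u [v [uX vX /negP Guv]]] : exists u v, [/\ u \in X, v \notin X & ~~ G u v].
  (* For [a, b >= 1] with [a + b = n], one has [a b >= n - 1], which exceeds the size of [F]. *)
  have : ~~ (finset.setX X (~: X)%SET \subset F).
    apply/negP => /subset_leq_card; rewrite cardsX.
    have := cardsC X; rewrite card_ord.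
    have : (0 < #|X|)%N by apply/card_gt0P; exists x.
    have : (0 < #|(~: X)%SET|)%N by apply/card_gt0P; exists y; rewrite inE.
    move: Fn; move: #|X| #|(~: X)%SET| #|F| => a b f.
    by case: a b => [//|a] [//|b]; nia.
  move=> /subsetPn[[u v]]; rewrite inE /= [v \in _]inE => /andP[uX vX] uvF.
  by exists u, v; split=> //; apply: contra uvF; exact: XF.
(* For an arc leaving [X], take the tail unless it is [u]. A tail lies in [X], so it is not [v]; a
   head chosen when the tail is [u] is not [v] either, since [(u, v)] is not an arc. *)
pose g (p : 'I_n * 'I_n) := if p.1 == u then p.2 else p.1.
pose S := [set g p | p in F & (p.1 \in X) && (p.2 \notin X)]%SET.
exists S.
  apply: leq_trans (leq_imset_card _ _) _.
  by apply: subset_leq_card; apply/fintype.subsetP => p; rewrite inE => /andP[].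
have uS : u \notin S.
  apply/negP => /imsetP[[a b]]; rewrite inE /g /= => /and3P[_ aX bX].
  by case: eqP => [_ ub|au /esym//]; rewrite -ub uX in bX.
have vS : v \notin S.
  apply/negP => /imsetP[[a b]]; rewrite inE /g /= => /and3P[abF aX bX].
  case: eqP => [au vb|_ va]; last by rewrite va aX in vX.
  by have := FG _ abF; rewrite inE /= au -vb.
apply/negP => /forallP/(_ (Sub u uS))/forallP/(_ (Sub v vS)).
(* Paths avoiding [S] cannot leave [X]: an arc leaving [X] belongs to [F], so one of its ends was
   put in [S]. *)
move=> /(@connect_invariant _ _ [pred a | val a \in X]) /= inX.
suff : v \in X by rewrite (negPf vX).
apply: inX => // a b Gab aX; apply/negPn/negP => bX.
have gS : g (val a, val b) \in S by rewrite imset_f// inE /= aX bX XF.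
move: gS; rewrite /g /=; case: ifP => _.
  by rewrite (negPf (valP b)).
by rewrite (negPf (valP a)).
Qed.

(** * Circulant digraphs *)

(** For [i, j < n] this is the residue of [j - i] modulo [n]. The case split keeps it within linear
    arithmetic, and neither subtraction is then truncated. *)
Definition cyc_dist (n i j : nat) : nat :=
  if (i <= j)%N then (j - i)%N else (j + n - i)%N.

Lemma cyc_dist_eq0 (n : nat) (i j : 'I_n) : cyc_dist n i j = 0 -> i = j.
Proof.
move=> d0; apply: val_inj; move: d0; rewrite /cyc_dist /=.
have := ltn_ord i; case: (leqP i j); lia.
Qed.

(** As [l] lies strictly between [i] and [j] on the cycle, the distances from [i] to [l] and from
    [l] to [j] add up. *)
Lemma cyc_dist_step (n : nat) (i j l : 'I_n) :
  (0 < cyc_dist n i l < cyc_dist n i j)%N ->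
  (cyc_dist n l j < cyc_dist n i j)%N.
Proof.
rewrite /cyc_dist; have := ltn_ord i; have := ltn_ord j; have := ltn_ord l.
case: (leqP i l); case: (leqP i j); case: (leqP l j); lia.
Qed.

Definition circulant_arc (n k : nat) (i j : 'I_n) : bool :=
  (0 < cyc_dist n i j <= k)%N.

Lemma circulant_irr (n k : nat) : irreflexive (@circulant_arc n k).
Proof. by move=> i; rewrite /circulant_arc /cyc_dist leqnn subnn. Qed.

Definition circulant (n k : nat) : digraph n := Digraph (@circulant_irr n k).

Lemma circulant_outdeg (n k : nat) (i : 'I_n) :
  (k < n)%N -> outdeg (circulant n k) i = k.
Proof.
move=> kn; have ni := ltn_ord i.
(* Reduction of [i + j] modulo [n]. The out-neighbours are its values at [1, ..., k], whence the
   shift [j.+1] on ['I_k]. *)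
pose f (j : nat) : nat := if (i + j < n)%N then (i + j)%N else (i + j - n)%N.
have fn (j : 'I_k) : (f j.+1 < n)%N.
  by rewrite /f; have := ltn_ord j; case: ifP; lia.
have -> : outdeg (circulant n k) i = #|[set Ordinal (fn j) | j : 'I_k]%SET|.
  congr #|pred_of_set _|; apply/setP => j; rewrite inE; apply/idP/imsetP => /=.
    rewrite /circulant_arc => /andP[d0 dk].
    have dk' : ((cyc_dist n i j).-1 < k)%N by lia.
    exists (Ordinal dk') => //; apply: val_inj => /=.
    have := ltn_ord j; rewrite /f prednK// /cyc_dist.
    by case: (leqP i j) => ij; case: ifP; lia.
  move=> [l _ ->]; rewrite /circulant_arc /cyc_dist /= /f.
  have := ltn_ord l; case: (ltnP (i + l.+1) n) => il /=; case: ifP; lia.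
rewrite card_imset ?card_ord// => a b /(congr1 val) /=.
rewrite /f => ab; apply: val_inj; move: ab; have := ltn_ord a; have := ltn_ord b.
by do 2![case: ifP] => /=; lia.
Qed.

(* Among the [k] successors of the current vertex one survives; stepping to it
   decreases the cyclic distance to the target. *)
Lemma circulant_delete_vertices (n k : nat) (S : {set 'I_n}) :
  (k < n)%N -> (#|S| < k)%N ->
  strongly_connected (@delete_vertices n (circulant n k) S).
Proof.
move=> kn Sk; apply/forallP => x; apply/forallP => y.
have [m] := ubnP (cyc_dist n (val x) (val y)).
elim: m x => [//|m IHm] x; rewrite ltnS => xym.
have [d0|d0] := posnP (cyc_dist n (val x) (val y)).
  by rewrite (val_inj (cyc_dist_eq0 d0)).
(* Within distance [k] the target is itself a successor. Beyond it, no successor overshoots the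
   target. *)
have [dk|kd] := leqP (cyc_dist n (val x) (val y)) k.
  by apply: connect1; rewrite /delete_vertices /= /circulant_arc d0.
have : ~~ ([set j | circulant n k (val x) j]%SET \subset S).
  apply: contraL Sk => /subset_leq_card; rewrite -leqNgt.
  by rewrite -[X in (X <= _)%N -> _]/(outdeg _ _) circulant_outdeg.
move=> /subsetPn[z]; rewrite inE => xz zS.
apply: (@connect_trans _ _ (Sub z zS)); first exact: connect1.
apply: IHm; apply: leq_trans xym; apply: cyc_dist_step.
by have /andP[-> zk] := xz; exact: leq_ltn_trans zk kd.
Qed.

(** By Whitney's inequality, an arc cut of fewer than [k] arcs would yield a vertex cut of fewer
    than [k] vertices. *)
Lemma circulant_delete_arcs (n k : nat) (F : {set 'I_n * 'I_n}) :
  (k.+1 < n)%N -> F \subset arcs (circulant n k) -> (#|F| < k)%N ->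
  strongly_connected (delete_arcs (circulant n k) F).
Proof.
move=> kn FG Fk; apply/negPn/negP => /arc_cut_vertex_cut[||S SF]//; first lia.
by rewrite circulant_delete_vertices//; lia.
Qed.

Lemma circulant_strongly_connected (n k : nat) :
  (0 < k)%N -> (k.+1 < n)%N -> strongly_connected (circulant n k).
Proof.
move=> k0 kn; have := @circulant_delete_arcs n k finset.set0 kn.
rewrite finset.sub0set cards0 => /(_ isT k0) /forallP Gc.
apply/forallP => x; apply/forallP => y; have /forallP/(_ y) := Gc x.
by apply: connect_sub => a b /andP[Gab _]; exact: connect1.
Qed.

Lemma circulant_D_nk (n k : nat) :
  (0 < k)%N -> (k.+1 < n)%N -> D_nk n k (circulant n k).
Proof.
move=> k0 kn; split; first exact: circulant_strongly_connected.
have n0 : (0 < n)%N by lia.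
split.
  exists [set j | circulant n k (Ordinal n0) j]%SET.
    by apply: delete_outneighbours; rewrite circulant_outdeg; lia.
  by apply: circulant_outdeg; lia.
move=> _ [S /= Sn <-]; rewrite leEnat leqNgt; apply: contra Sn.
by apply: circulant_delete_vertices; lia.
Qed.

Lemma circulant_L_nk (n k : nat) :
  (0 < k)%N -> (k.+1 < n)%N -> L_nk n k (circulant n k).
Proof.
move=> k0 kn; split; first exact: circulant_strongly_connected.
have n0 : (0 < n)%N by lia.
split.
  exists (out_arcs (circulant n k) (Ordinal n0)).
    by apply: delete_out_arcs; lia.
  by rewrite card_out_arcs circulant_outdeg//; lia.
move=> _ [F /= /andP[FG Fn] <-]; rewrite leEnat leqNgt; apply: contra Fn.
by apply: circulant_delete_arcs.
Qed.

(** * The minimum and its minimizers *)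

Lemma is_min_unique (d : Order.disp_t) (T : porderType d) (A : set T) (x y : T) :
  is_min A x -> is_min A y -> x = y.
Proof. by move=> [Ax lx] [Ay ly]; apply/le_anti; rewrite lx// ly. Qed.

(** Vertex and arc connectivity enter only through the degree bounds and the membership of the
    circulant, so one abstract class [C] serves for both. *)
Lemma min_lambda_alpha (R : realType) (alpha : R) (n k : nat)
    (C : set (digraph n)) :
  0 <= alpha < 1 -> (0 < k)%N -> (k.+1 < n)%N ->
  (forall G, C G -> strongly_connected G) ->
  (forall G, C G -> forall i, (k <= outdeg G i)%N /\ (k <= indeg G i)%N) ->
  C (circulant n k) ->
  is_min [set lambda_alpha alpha G | G in C] k%:R /\
  (forall G, C G ->
    is_min [set lambda_alpha alpha H | H in C] (lambda_alpha alpha G) ->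
    regular k G).
Proof.
move=> alphaP k0 kn Csc Cdeg Ccirc; have n0 : (0 < n)%N by lia.
have lamk G : C G -> k%:R <= lambda_alpha alpha G /\
    (lambda_alpha alpha G = k%:R -> forall i, outdeg G i = k).
  by move=> CG; apply: outdeg_lambda_alpha => // [|i]; [exact: Csc|have [] := Cdeg G CG i].
have kmin : is_min [set lambda_alpha alpha G | G in C] k%:R.
  split; last by move=> _ [G CG <-]; have [] := lamk G CG.
  exists (circulant n k) => //; apply: lambda_alpha_outregular => // [|i].
    exact: Csc.
  by apply: circulant_outdeg; lia.
split=> // G CG Gmin; apply: outregular_regular => i.
  by have [_] := lamk G CG; apply; exact: is_min_unique Gmin kmin.
by have [] := Cdeg G CG i.
Qed.

Theorem theorem6p3 (R : realType) (alpha : R) (n k : nat)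
    (alpha_range : 0 <= alpha < 1) (k_range : (1 <= k <= n - 2)%N) :
  [/\ forall G : digraph n,
        D_nk n k G ->
        is_min [set lambda_alpha alpha H | H in D_nk n k] (lambda_alpha alpha G) ->
        regular k G,
      forall G : digraph n,
        L_nk n k G ->
        is_min [set lambda_alpha alpha H | H in L_nk n k] (lambda_alpha alpha G) ->
        regular k G,
      is_min [set lambda_alpha alpha G | G in D_nk n k] k%:R &
      is_min [set lambda_alpha alpha G | G in L_nk n k] k%:R].
Proof.
have k0 : (0 < k)%N by lia.
(* Since [k] is positive, the natural subtraction [n - 2] is not truncated. *)
have kn : (k.+1 < n)%N by lia.
have [] := @min_lambda_alpha R alpha n k (D_nk n k) alpha_range k0 kn.
- by move=> G [].
- by move=> G [_]; exact: vertex_connectivity_degree.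
- exact: circulant_D_nk.
have [] := @min_lambda_alpha R alpha n k (L_nk n k) alpha_range k0 kn.
- by move=> G [].
- by move=> G [_]; apply: arc_connectivity_degree; lia.
- exact: circulant_L_nk.
by move=> minL regL minD regD; split.
Qed.
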